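(* Let $(X,\rho)$ be a metric space and let $\mathcal{B}$ be a bornology on $X$ with a closed base. Then $$t(\tau_{\mathcal B})=L(X,\mathcal B)\qquad\text{and}\qquad t(\tau^s_{\mathcal B})=L^s(X,\mathcal B).$$
   Context: A bornology on a set $X$ is a family $\mathcal B$ of subsets of $X$ that is closed under taking subsets, closed under finite unions, and satisfies $\bigcup\mathcal B=X$. A base of $\mathcal B$ is a subfamily $\mathcal B_0\subset\mathcal B$ such that every $B\in\mathcal B$ is contained in some $B_0\in\mathcal B_0$; $\mathcal B$ has a closed base if it has a base consisting of closed sets (equivalently $\overline B\in\mathcal B$ for all $B\in\mathcal B$). For $B\subset X$ and $\delta>0$, $B^\delta=\{x\in X:\exists b\in B,\ \rho(x,b)<\delta\}$. A family $\mathcal U$ of open subsets of $X$ is an open $\mathcal B$-cover of $X$ if for every $B\in\mathcal B$ there is $U\in\mathcal U$ with $B\subset U$; it is a strong open $\mathcal B$-cover if for every $B\in\mathcal B$ there are $U\in\mathcal U$ and $\delta>0$ with $B^\delta\subset U$. $L(X,\mathcal B)$ (respectively $L^s(X,\mathcal B)$) is $\aleph_0$ plus the least cardinal $\mathfrak m$ such that every open $\mathcal B$-cover (respectively strong open $\mathcal B$-cover) of $X$ has a subfamily of cardinality $\le\mathfrak m$ which is still an open $\mathcal B$-cover (respectively a strong open $\mathcal B$-cover) of $X$. $C(X)$ is the set of continuous functions $X\to\mathbb R$. The topology $\tau_{\mathcal B}$ on $C(X)$ is induced by the uniformity with basic entourages $[B,\epsilon]=\{(f,g):\forall x\in B,\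 |f(x)-g(x)|<\epsilon\}$, and $\tau^s_{\mathcal B}$ by the uniformity with basic entourages $[B,\epsilon]^s=\{(f,g):\exists\delta>0\ \forall x\in B^\delta,\ |f(x)-g(x)|<\epsilon\}$, where $B\in\mathcal B$, $\epsilon>0$. $t(\tau)$ denotes the tightness of $(C(X),\tau)$: the least infinite cardinal $\kappa$ such that whenever $f\in\overline{A}$ there is $A_0\subset A$ with $|A_0|\le\kappa$ and $f\in\overline{A_0}$. *)

(* Defs.v *)
From HB Require Import structures.
From mathcomp Require Import all_boot all_order all_algebra.
From mathcomp Require Import mathcomp_extra boolp classical_sets functions.
From mathcomp Require Import cardinality reals topology normedtype.

Set Implicit Arguments.
Unset Strict Implicit.
Unset Printing Implicit Defensive.

Import Order.TTheory GRing.Theory Num.Theory.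
Import numFieldNormedType.Exports.

Local Open Scope classical_set_scope.
Local Open Scope ring_scope.
Local Open Scope card_scope.

(* A cardinal is represented by a type of that cardinality; equality of
   cardinals is equipotence [#=] of the full sets of these types. *)
Section cardinals.

Lemma card_le_setTP (T U : Type) :
  [set: T] #<= [set: U] <-> exists f : T -> U, injective f.
Proof.
split=> [/card_leP[f]|[f finj]].
  exists (fun x => val (f (SigSub (mem_set (I : [set: T] x))))).
  move=> x y /val_inj fxy.
  have := 'inj_f (mem_set I) (mem_set I) fxy.
  by move=> /(congr1 val).
have : range f #= [set: T] by apply: inj_card_eq => x y _ _; exact: finj.
rewrite card_eq_le => /andP[_ Tf]; apply: card_le_trans Tf _.
exact: subset_card_le.
Qed.

Lemma min_card (J : Type) (T : J -> Type) : inhabited J ->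
  exists i, forall j, [set: T i] #<= [set: T j].
Proof.
case=> i0.
pose P (F : set (forall i, T i)) :=
  forall i h h', F h -> F h' -> h i = h' i -> h = h'.
have [] := @Zorn_bigcup _ P.
  move=> FF FFP tot i h h' [A FA Ah] [B FB Bh'] hh'.
  by have [AB|BA] := tot _ _ FA FB;
    [apply: (FFP _ FB _ _ _ _ _ hh') => //; exact: AB|
     apply: (FFP _ FA _ _ _ _ _ hh') => //; exact: BA].
move=> F [PF maxF].
have [[i Fi]|noi] :=
    pselect (exists i, forall x : T i, exists h, F h /\ h i = x).
  exists i => j; have [s sP] := choice Fi.
  apply/card_le_setTP; exists (fun x => s x j) => x y /= sxy.
  have [[Fx <-] [Fy <-]] := (sP x, sP y).
  by rewrite (PF j _ _ Fx Fy sxy).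
have new i : {x : T i | forall h, F h -> h i <> x}.
  apply: cid; apply: contrapT => nx; apply: noi; exists i => x.
  apply: contrapT => nh; apply: nx; exists x => h Fh hx.
  by apply: nh; exists h.
pose g i := sval (new i).
have gP i h : F h -> h i <> g i by exact: (svalP (new i)).
exfalso; apply: (maxF (F `|` [set g])).
  split; first by move=> h Fh; left.
  by move=> Fg; exact: (gP i0 g (Fg g (or_intror erefl)) erefl).
move=> i h h' [Fh|->] [Fh'|->] //; first exact: PF.
  by move=> /(gP _ _ Fh).
by move/esym/(gP _ _ Fh').
Qed.

Lemma least_cardinal_subproof (P : Type -> Prop) :
    (exists K, P K) ->
    (forall K K' : Type, [set: K] #<= [set: K'] -> P K -> P K') ->
  exists K, P K /\ forall K', P K' -> [set: K] #<= [set: K'].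
Proof.
move=> [K0 PK0] Pup.
have PT : P [set: K0].
  by apply: Pup PK0; apply/card_le_setTP;
    exists (fun x => SigSub (mem_set (I : [set: K0] x))) => x y [].
pose J := {S : set K0 | P S}.
have [[S PS] Smin] := @min_card J (fun S => sval S)
  (inhabits (exist (fun S : set K0 => P S) setT PT)).
exists S; split=> // K PK.
have [[] bmin] := @min_card bool (fun b => if b then K0 else K)
    (inhabits true); last first.
  have /card_le_setTP[f finj] := bmin true.
  have eqfK : range f #= [set: K].
    by apply: inj_card_eq => x y _ _; exact: finj.
  have eqfK' : [set: range f] #= [set: K].
    by apply: card_eq_trans eqfK; exact: card_setT.
  move: eqfK'; rewrite card_eq_le => /andP[lefK leKf].
  have Pf : P (range f) by exact: Pup PK.
  by apply: card_le_trans lefK; exact: (Smin (exist _ _ Pf)).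
apply: card_le_trans (bmin false).
apply: card_le_trans (Smin (exist _ _ PT)) _ => /=.
by apply/card_le_setTP; exists val; exact: val_inj.
Qed.

(* The hypotheses make the choice below meaningful: a property of cardinals
   that holds somewhere and is upward closed (in particular invariant under
   equipotence). *)
Definition least_cardinal (P : Type -> Prop) (Pex : exists K, P K)
    (Pup : forall K K' : Type, [set: K] #<= [set: K'] -> P K -> P K') : Type :=
  sval (cid (least_cardinal_subproof Pex Pup)).

Lemma least_cardinalP (P : Type -> Prop) (Pex : exists K, P K)
    (Pup : forall K K' : Type, [set: K] #<= [set: K'] -> P K -> P K') :
  P (least_cardinal Pex Pup) /\
  forall K, P K -> [set: least_cardinal Pex Pup] #<= [set: K].
Proof. exact: (svalP (cid (least_cardinal_subproof Pex Pup))). Qed.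

End cardinals.

Section tightness.
Variable T : topologicalType.

Definition tightness_bound (K : Type) : Prop :=
  infinite_set [set: K] /\
  forall (A : set T) (f : T), closure A f ->
    exists A0, [/\ A0 `<=` A, A0 #<= [set: K] & closure A0 f].

Lemma tightness_bound_ex : exists K, tightness_bound K.
Proof.
exists (nat + T)%type; split=> [|A f Af].
  by apply/infiniteP/card_le_setTP; exists inl => x y [].
exists A; split=> //; apply: (@card_le_trans _ _ _ [set: T]).
  exact: subset_card_le.
by apply/card_le_setTP; exists inr => x y [].
Qed.

Lemma tightness_bound_up (K K' : Type) : [set: K] #<= [set: K'] ->
  tightness_bound K -> tightness_bound K'.
Proof.
move=> KK' [/infiniteP Kinf KP]; split=> [|A f /KP[A0 [A0A A0K A0f]]].
  by apply/infiniteP; exact: card_le_trans KK'.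
by exists A0; split=> //; exact: card_le_trans KK'.
Qed.

Definition tightness : Type :=
  least_cardinal tightness_bound_ex tightness_bound_up.

End tightness.

(* [bornology0] is the union of the empty subfamily; it only matters when [X]
   is empty. *)
Record bornology (X : Type) := Bornology {
  bornology_sets : set (set X) ;
  bornology_sub : forall A B : set X,
    bornology_sets B -> A `<=` B -> bornology_sets A ;
  bornology0 : bornology_sets set0 ;
  bornologyU : forall A B : set X,
    bornology_sets A -> bornology_sets B -> bornology_sets (A `|` B) ;
  bornology_cover : \bigcup_(A in bornology_sets) A = [set: X] }.

Definition bornology_base (X : Type) (B : bornology X) (B0 : set (set X)) :=
  B0 `<=` bornology_sets B /\
  forall A, bornology_sets B A -> exists2 A0, B0 A0 & A `<=` A0.

Definition has_closed_base (X : topologicalType) (B : bornology X) :=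
  exists B0, bornology_base B B0 /\ forall A, B0 A -> closed A.

Section covers.
Context {R : realType} {X : metricType R}.

Definition enlargement (A : set X) (d : R) : set X :=
  [set x | exists2 a, A a & mdist x a < d].

Lemma sub_enlargement (A A' : set X) (d d' : R) : A `<=` A' -> d <= d' ->
  enlargement A d `<=` enlargement A' d'.
Proof.
by move=> AA' dd' x [a /AA' Aa xa]; exists a => //; exact: lt_le_trans dd'.
Qed.

Variable B : bornology X.

Definition open_cover (U : set (set X)) : Prop :=
  (forall V, U V -> open V) /\
  forall A, bornology_sets B A -> exists2 V, U V & A `<=` V.

Definition strong_open_cover (U : set (set X)) : Prop :=
  (forall V, U V -> open V) /\
  forall A, bornology_sets B A ->
    exists V d, [/\ U V, 0 < d & enlargement A d `<=` V].

Definition subcover_bound (iscover : set (set X) -> Prop) (K : Type) : Prop :=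
  forall U, iscover U ->
    exists U0, [/\ U0 `<=` U, U0 #<= [set: K] & iscover U0].

Lemma subcover_bound_ex (iscover : set (set X) -> Prop) :
  exists K, subcover_bound iscover K.
Proof.
exists (set X) => U Ucov; exists U; split=> //.
exact: subset_card_le.
Qed.

Lemma subcover_bound_up (iscover : set (set X) -> Prop) (K K' : Type) :
  [set: K] #<= [set: K'] -> subcover_bound iscover K ->
  subcover_bound iscover K'.
Proof.
move=> KK' KP U /KP[U0 [U0U U0K U0cov]]; exists U0; split=> //.
exact: card_le_trans KK'.
Qed.

(* The sum of types is the sum of cardinals. *)
Definition lindelof_number : Type :=
  (nat + least_cardinal (subcover_bound_ex open_cover)
                        (@subcover_bound_up open_cover))%type.

Definition strong_lindelof_number : Type :=
  (nat + least_cardinal (subcover_bound_ex strong_open_cover)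
                        (@subcover_bound_up strong_open_cover))%type.

End covers.

(* [C_born B] and [C_sborn B] are aliases of C(X), so that each carries its own
   uniformity: that of tau_B and of tau^s_B respectively. *)
Definition C_born (R : realType) (X : metricType R) (B : bornology X) :=
  continuousType X R.

Section C_born.
Context {R : realType} {X : metricType R} (B : bornology X).
Local Notation CX := (C_born B).

Definition born_ent (A : set X) (e : R) : set (CX * CX) :=
  [set fg : CX * CX | forall x, A x -> `|fg.1 x - fg.2 x| < e].

Definition born_entourage : set_system (CX * CX) :=
  [set W | exists A e, [/\ bornology_sets B A, 0 < e & born_ent A e `<=` W]].

HB.instance Definition _ := Choice.copy CX (continuousType X R).

Let born_filter : Filter born_entourage.
Proof.
split.
- by exists set0, 1; split=> //; exact: bornology0.
- move=> W W' [A [e [BA e0 AW]]] [A' [e' [BA' e'0 AW']]].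
  exists (A `|` A'), (Num.min e e'); split.
  + exact: bornologyU.
  + by rewrite lt_min e0.
  + move=> fg H; split.
    * by apply: AW => x Ax; have := H x (or_introl Ax); rewrite lt_min => /andP[].
    * by apply: AW' => x Ax; have := H x (or_intror Ax); rewrite lt_min => /andP[].
- move=> W W' WW' [A [e [BA e0 AW]]]; exists A, e; split=> //.
  exact: subset_trans WW'.
Qed.

Let born_diagonal W : born_entourage W -> diagonal `<=` W.
Proof.
move=> [A [e [BA e0 AW]]] [f g] /= fg; apply: AW => x _ /=.
by rewrite (fg : f = g) subrr normr0.
Qed.

Let born_inv W : born_entourage W -> born_entourage W^-1%relation.
Proof.
move=> [A [e [BA e0 AW]]]; exists A, e; split=> // -[f g] /= H.
by apply: AW => x Ax /=; rewrite distrC; exact: H.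
Qed.

Let born_split W : born_entourage W ->
  exists2 V, born_entourage V & (V \; V `<=` W)%relation.
Proof.
move=> [A [e [BA e0 AW]]]; exists (born_ent A (e / 2)).
  by exists A, (e / 2); split=> //; rewrite divr_gt0.
move=> [f g] /= [h fh hg]; apply: AW => x Ax /=.
have := ltrD (fh x Ax) (hg x Ax); rewrite /= -splitr; apply: le_lt_trans.
exact: ler_distD.
Qed.

HB.instance Definition _ := isUniform.Build CX
  born_filter born_diagonal born_inv born_split.

End C_born.

Arguments born_ent {R X} B A e.

Definition C_sborn (R : realType) (X : metricType R) (B : bornology X) :=
  continuousType X R.

Section C_sborn.
Context {R : realType} {X : metricType R} (B : bornology X).
Local Notation CX := (C_sborn B).

Definition sborn_ent (A : set X) (e : R) : set (CX * CX) :=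
  [set fg : CX * CX | exists2 d, 0 < d &
    forall x, enlargement A d x -> `|fg.1 x - fg.2 x| < e].

Definition sborn_entourage : set_system (CX * CX) :=
  [set W | exists A e, [/\ bornology_sets B A, 0 < e & sborn_ent A e `<=` W]].

HB.instance Definition _ := Choice.copy CX (continuousType X R).

Let sborn_filter : Filter sborn_entourage.
Proof.
split.
- by exists set0, 1; split=> //; exact: bornology0.
- move=> W W' [A [e [BA e0 AW]]] [A' [e' [BA' e'0 AW']]].
  exists (A `|` A'), (Num.min e e'); split.
  + exact: bornologyU.
  + by rewrite lt_min e0.
  + move=> fg [d d0 H]; split; [apply: AW|apply: AW']; exists d => // x Ax.
    * have /H : enlargement (A `|` A') d x.
        by apply: sub_enlargement Ax => // y; left.
      by rewrite lt_min => /andP[].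
    * have /H : enlargement (A `|` A') d x.
        by apply: sub_enlargement Ax => // y; right.
      by rewrite lt_min => /andP[].
- move=> W W' WW' [A [e [BA e0 AW]]]; exists A, e; split=> //.
  exact: subset_trans WW'.
Qed.

Let sborn_diagonal W : sborn_entourage W -> diagonal `<=` W.
Proof.
move=> [A [e [BA e0 AW]]] [f g] /= fg; apply: AW; exists 1 => //= x _.
by rewrite (fg : f = g) subrr normr0.
Qed.

Let sborn_inv W : sborn_entourage W -> sborn_entourage W^-1%relation.
Proof.
move=> [A [e [BA e0 AW]]]; exists A, e; split=> // -[f g] /= [d d0 H].
by apply: AW; exists d => //= x Ax; rewrite distrC; exact: H.
Qed.

Let sborn_split W : sborn_entourage W ->
  exists2 V, sborn_entourage V & (V \; V `<=` W)%relation.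
Proof.
move=> [A [e [BA e0 AW]]]; exists (sborn_ent A (e / 2)).
  by exists A, (e / 2); split=> //; rewrite divr_gt0.
move=> [f g] /= [h [d d0 fh] [d' d'0 hg]].
apply: AW; exists (Num.min d d'); first by rewrite lt_min d0.
move=> x Ax /=.
have {}fh : `|f x - h x| < e / 2.
  by apply: fh; apply: sub_enlargement Ax => //; rewrite ge_min lexx.
have {}hg : `|h x - g x| < e / 2.
  by apply: hg; apply: sub_enlargement Ax => //; rewrite ge_min lexx orbT.
have := ltrD fh hg; rewrite /= -splitr; apply: le_lt_trans.
exact: ler_distD.
Qed.

HB.instance Definition _ := isUniform.Build CX
  sborn_filter sborn_diagonal sborn_inv sborn_split.

End C_sborn.

Arguments sborn_ent {R X} B A e.

(* Main.v *)
(* Tightness <= covering number: if [f] is in the closure of [A], then for each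
   [n] the sets [{x | |f x - g x| < 1/(n+1)}], [g] in [A], form an open cover;
   the [g] occurring in small subcovers, for all [n], make up the required part
   of [A]. Covering number <= tightness: given an open cover [U], Urysohn
   functions put [0] in the closure of the set of [g] with [|g| >= 1] off some
   [V] in [U]; the [V] attached to a small subset with [0] in its closure form a
   subcover, since [|g| < 1] on [D] forces [D] into [V]. The first
   half uses [aleph_0 * K = K] for infinite cardinals [K]. *)

Require Import Defs.
From mathcomp Require Import all_boot all_order all_algebra.
From mathcomp Require Import mathcomp_extra boolp classical_sets functions.
From mathcomp Require Import cardinality reals topology normedtype.

Import Order.TTheory GRing.Theory Num.Theory.
Import numFieldNormedType.Exports.

Local Open Scope classical_set_scope.
Local Open Scope card_scope.

(** * Arithmetic of infinite cardinals *)

Lemma card_le_exists_inj (T U : Type) (A : set T) :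
  inhabited U -> A #<= [set: U] -> exists f : T -> U, {in A &, injective f}.
Proof.
move=> [u]; rewrite -(card_le_eql (card_setT A)) => /card_le_setTP[f finj].
exists (fun x => if pselect (A x) is left Ax then f (SigSub (mem_set Ax)) else u).
move=> x y /set_mem Ax /set_mem Ay; case: pselect => // Ax'.
by case: pselect => // Ay' /finj/(congr1 val).
Qed.

(* By Zorn, all but finitely many elements of [K] are covered by disjoint
   injective sequences, and pairs of naturals can be coded in the index of a
   sequence. *)
Lemma card_nat_prod_le (K : Type) :
  infinite_set [set: K] -> [set: nat * K] #<= [set: K].
Proof.
move=> Kinf.
have [E [Einj Etriv Emax]] := ex_maximal_disjoint_subcollection
  (fun s : nat -> K => range s) [set s | injective s].
set C := \bigcup_(s in E) range s.
(* Otherwise an injective sequence would run inside the complement of [C] and could be added to [E],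
   against maximality. *)
have finC : finite_set (~` C).
  apply: contrapT => /infiniteP.
  rewrite -(card_le_eqr (card_setT _)) => /card_le_setTP[f finj].
  pose s n := val (f n).
  have sC n : ~ C (s n) by exact: (set_mem (valP (f n))).
  have nEs : ~ E s by move=> Es; apply: (sC 0); exists s => //; exists 0.
  apply: (Emax (E `|` [set s])).
  - by split; [move=> t; left|move=> /(_ s (or_intror erefl))].
  - move=> t [/Einj//|->] m n /val_inj; exact: finj.
  move=> t u [Et|->] [Eu|->] //; first exact: Etriv.
  - move=> [x [[m _ mx] [n _ nx]]]; case: (sC n).
    by exists t => //; exists m; rewrite // mx.
  - move=> [x [[m _ mx] [n _ nx]]]; case: (sC m).
    by exists u => //; exists n; rewrite // nx.
have [s0 Es0] : E !=set0.
  apply/set0P/eqP => E0; apply: Kinf; move: finC.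
  by rewrite /C E0 bigcup_set0 setC0.
have [i iinj] : exists i : K -> nat, {in ~` C &, injective i}.
  apply: card_le_exists_inj; first by constructor; exact: 0.
  exact: finite_set_countable.
(* The flag tells whether [k] sits at position [c.2.2] of the sequence [c.1], or is a leftover point
   numbered by [i]. *)
pose Q k (c : (nat -> K) * (bool * nat)) := E c.1 /\
  if c.2.1 then c.1 c.2.2 = k else ~ C k /\ c.2.2 = i k.
have [c cP] : {c & forall k, Q k (c k)}.
  apply: choice => k; have [[s Es [n _ snk]]|nCk] := pselect (C k).
    by exists (s, (true, n)); split.
  by exists (s0, (false, i k)); split.
(* Disjointness of ranges recovers the sequence from the value, injectivity its argument; sequence,
   flag and index then determine [k]. *)
apply/card_le_setTP; exists (fun nk => (c nk.2).1 (pickle (nk.1, (c nk.2).2))).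
move=> [m k] [n l] /= eqkl; have [Ek Qk] := cP k; have [El Ql] := cP l.
have eq1 : (c k).1 = (c l).1.
  by apply: Etriv => //; exists ((c k).1 (pickle (m, (c k).2))); split;
    [|rewrite eqkl]; eexists.
move: eqkl; rewrite eq1 => /(Einj _ El)/(pcan_inj pickleK)[-> eq2].
congr (_, _); move: Qk Ql; rewrite eq1 eq2; case: ifP => _; first by move=> -> ->.
by move=> [Ck ->] [Cl]; apply: iinj; rewrite inE.
Qed.

Lemma card_nat_sum_le (K L : Type) : infinite_set [set: K] ->
  [set: L] #<= [set: K] -> [set: nat + L] #<= [set: K].
Proof.
move=> Kinf /card_le_setTP[f finj]; apply: card_le_trans (card_nat_prod_le _ Kinf).
have [k0 _] := infinite_setN0 Kinf; apply/card_le_setTP.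
(* The shift to [n.+1] reserves first coordinate 0 for [L]. *)
exists (fun x => match x with inl n => (n.+1, k0) | inr l => (0, f l) end).
by move=> [m|k] [n|l] //; [case=> ->|move=> -[/finj->]].
Qed.

(** Tagging each point with the index of one set containing it makes the injections of the separate
    sets jointly injective. *)
Lemma bigcup_nat_card_le (T K : Type) (A : nat -> set T) :
  infinite_set [set: K] -> (forall n, A n #<= [set: K]) ->
  \bigcup_n A n #<= [set: K].
Proof.
move=> Kinf AK; apply: card_le_trans (card_nat_prod_le _ Kinf).
have [k0 _] := infinite_setN0 Kinf.
have [|h hinj] := @choice _ _ (fun n (g : T -> K) => {in A n &, injective g}).
  by move=> n; apply: card_le_exists_inj => //; constructor.
have [|N NP] := @choice _ _ (fun x n => (\bigcup_n A n) x -> A n x).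
  move=> x; have [[n _ Anx]|nA] := pselect ((\bigcup_n A n) x).
    by exists n.
  by exists 0.
have cardA : [set (N x, h (N x) x) | x in \bigcup_n A n] #= \bigcup_n A n.
  apply: inj_card_eq => x y /set_mem Ax /set_mem Ay [eqN].
  rewrite eqN; apply: hinj; apply/mem_set; last exact: NP.
  by rewrite -eqN; exact: NP.
rewrite -(card_le_eql cardA); exact: subset_card_le.
Qed.

(** * Normality of pseudometric spaces *)

Local Open Scope ring_scope.

Lemma pseudometric_normal (R : realType) (X : pseudoMetricType R) :
  normal_space X.
Proof.
apply/(@normal_openP R) => A B clA clB AB0.
(* Half-balls around points of [C] whose full balls miss [D]; interiors are taken because [ball]
   need not be open. If two half-balls meet, the larger full ball contains the other centre. *)
pose N (C D : set X) := [set x | exists a (r : R),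
  [/\ C a, 0 < r, (forall y, D y -> ~ ball a r y) & (ball a (r / 2))° x]].
have oN C D : open (N C D).
  rewrite openE => x [a [r [Ca r0 Dar arx]]].
  apply: filterS (open_nbhs_nbhs (conj (open_interior _) arx)) => y ary.
  by exists a, r.
have subN C D : closed D -> C `&` D = set0 -> C `<=` N C D.
  move=> clD CD0 x Cx.
  have : nbhs x (~` D).
    apply: open_nbhs_nbhs; split; first exact: closed_openC.
    by move=> Dx; have : (C `&` D) x by []; rewrite CD0.
  move=> /nbhs_ballP[r /= r0 rD]; exists x, r; split=> //.
    by move=> y Dy /rD.
  by apply: nbhsx_ballx; rewrite divr_gt0.
have half_ball (a b : X) (r s : R) x : s <= r ->
    ball a (r / 2) x -> ball b (s / 2) x -> ball a r b.
  move=> sr ax bx; rewrite [r]splitr; apply: ball_triangle ax _.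
  by apply: ball_sym; apply: le_ball bx; rewrite ler_pM2r// invr_gt0.
exists (N A B), (N B A); split=> //; first exact: subN.
  by apply: subN; rewrite 1?setIC.
rewrite -subset0 => x [[a [r [Aa r0 ar /interior_subset ax]]]].
move=> [b [s [Bb s0 bs /interior_subset bx]]].
have [sr|/ltW rs] := leP s r; first
  by apply: (ar b Bb); exact: half_ball ax bx.
by apply: (bs a Aa); exact: half_ball bx ax.
Qed.

(** * Tightness against covering number, for both topologies at once *)

Section function_space_tightness.
Context {R : realType} {X : metricType R} {T : topologicalType}.
(* [S D V] is the inclusion of [D], respectively of some enlargement of [D], in
   [V]. *)
Variables (ev : T -> X -> R) (F : set (set X)) (S : set X -> set X -> Prop).
Variable iscover : set (set X) -> Prop.
Hypothesis ev_cont : forall f, continuous (ev f).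
Hypothesis S_up : forall D V W, V `<=` W -> S D V -> S D W.
Hypothesis iscoverP : forall U, iscover U <->
  (forall V, U V -> open V) /\ forall D, F D -> exists2 V, U V & S D V.
Hypothesis closureP : forall A f, closure A f <->
  forall D e, F D -> 0 < e ->
    exists2 g, A g & S D [set x | `|ev f x - ev g x| < e].
Variable f0 : T.
(* [D'] is a closed set of the bornology containing [D] for the first topology,
   and [D] itself for the second one. *)
Hypothesis separation : forall D, F D -> exists2 D', F D' &
  forall V, open V -> S D' V ->
    exists g, (forall x, ~ V x -> 1 <= `|ev f0 x - ev g x|) /\
      S D [set x | ev f0 x = ev g x].

Lemma tightness_bound_of_subcover_bound (K : Type) :
  infinite_set [set: K] -> subcover_bound iscover K -> tightness_bound T K.
Proof.
move=> Kinf Kcov; split=> // A f /closureP Af.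
pose V n g := [set x | `|ev f x - ev g x| < n.+1%:R^-1].
have [|G GP] := @choice _ _ (fun n (G : set T) => [/\ G `<=` A, G #<= [set: K] &
    forall D, F D -> exists2 g, G g & S D (V n g)]).
  move=> n.
  have /Kcov[U [UV UK /iscoverP[_ UF]]] : iscover (V n @` A).
    apply/iscoverP; split=> [_ [g _ <-]|D FD].
      rewrite (_ : V n g = (fun x => `|ev f x - ev g x|) @^-1`
        [set y | y < n.+1%:R^-1])//.
      apply: open_comp; last exact: open_lt.
      by move=> x _; apply: cvg_norm; apply: cvgB; exact: ev_cont.
    have [|g Ag Sg] := Af D n.+1%:R^-1 FD; first by rewrite invr_gt0.
    by exists (V n g) => //; exists g.
  (* [h] picks a function of [A] for each member of [U]; outside [U] the value [f] is a dummy. *)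
  have [|h hP] := @choice _ _ (fun W g => U W -> A g /\ V n g = W).
    move=> W; have [/UV[g Ag <-]|nUW] := pselect (U W).
      by exists g.
    by exists f.
  exists (h @` U); split.
  - by move=> _ [W /hP[AW _] <-].
  - exact: card_le_trans (card_image_le _ _) UK.
  - move=> D /UF[W UW SW]; exists (h W); first by exists W.
    by have [_ ->] := hP W UW.
exists (\bigcup_n G n); split.
- by move=> g [n _]; have [GA _ _] := GP n; exact: GA.
- by apply: bigcup_nat_card_le => // n; have [] := GP n.
apply/closureP => D e FD e0.
have [n ne] : exists n, n.+1%:R^-1 < e.
  by have [n /= ne] := ltr_add_invr e0; exists n; move: ne; rewrite add0r.
have [_ _ /(_ D FD)[g Gg Sg]] := GP n.
exists g; first by exists n.
by apply: S_up Sg => x /= /lt_trans; exact.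
Qed.

Lemma subcover_bound_of_tightness_bound (K : Type) :
  tightness_bound T K -> subcover_bound iscover K.
Proof.
move=> [_ KT] U /iscoverP[Uop UF].
pose A := [set g | exists2 V, U V & forall x, ~ V x -> 1 <= `|ev f0 x - ev g x|].
have [|G [GA GK /closureP Gf0]] := KT A f0.
  (* Covering [D'] instead of [D] yields a [g] that agrees with [f0] on [D] in the sense of [S],
     hence is [e]-close there for every [e]. *)
  apply/closureP => D e FD e0; have [D' FD' sepD'] := separation D FD.
  have [V UV SV] := UF D' FD'; have [g [g1 Sg]] := sepD' V (Uop V UV) SV.
  exists g; first by exists V.
  by apply: S_up Sg => x /= ->; rewrite subrr normr0.
have [|h hP] := @choice _ _ (fun g W => A g -> U W /\
    forall x, ~ W x -> 1 <= `|ev f0 x - ev g x|).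
  move=> g; have [[V UV g1]|nAg] := pselect (A g); first by exists V.
  by exists set0.
exists (h @` G); split.
- by move=> _ [g /GA/hP[Uhg _] <-].
- exact: card_le_trans (card_image_le _ _) GK.
apply/iscoverP; split=> [_ [g /GA/hP[/Uop + _] <-] //|D FD].
have [g Gg Sg] := Gf0 D 1 FD ltr01; exists (h g); first by exists g.
have [_ hg] := hP g (GA g Gg).
by apply: S_up Sg => x /=; apply: contraPP => /hg; rewrite leNgt => /negP.
Qed.

Lemma tightness_subcover_bound
    (Pex : exists K, subcover_bound iscover K)
    (Pup : forall K K' : Type, [set: K] #<= [set: K'] ->
      subcover_bound iscover K -> subcover_bound iscover K') :
  [set: tightness T] #= [set: nat + least_cardinal Pex Pup].
Proof.
have [tT tmin] := least_cardinalP (tightness_bound_ex T) (@tightness_bound_up T).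
have [LL Lmin] := least_cardinalP Pex Pup.
rewrite card_eq_le; apply/andP; split.
  apply: tmin; apply: tightness_bound_of_subcover_bound.
    by apply/infiniteP/card_le_setTP; exists inl => x y [].
  by apply: (Pup _ _ _ LL); apply/card_le_setTP; exists inr => x y [].
(* Tightness is infinite by definition, so it absorbs the summand [nat]. *)
apply: (card_nat_sum_le _ _ tT.1).
by apply: Lmin; exact: subcover_bound_of_tightness_bound.
Qed.

End function_space_tightness.

(** * Closures in the two topologies *)

Lemma closure_born (R : realType) (X : metricType R) (B : bornology X)
    (A : set (C_born B)) (f : C_born B) :
  closure A f <-> forall D (e : R), bornology_sets B D -> 0 < e ->
    exists2 g, A g & forall x, D x -> `|f x - g x| < e.
Proof.
split=> [Af D e BD e0|Af W].
  have [|g [Ag fg]] := Af [set g | born_ent B D e (f, g)]; last by exists g.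
  rewrite -nbhs_entourageE; exists (born_ent B D e); last first.
    by move=> g /xsectionP.
  by exists D, e; split; last exact: subset_refl.
rewrite -nbhs_entourageE => -[E [D [e [BD e0 DE]]] EW].
by have [g Ag fg] := Af D e BD e0; exists g; split=> //; apply/EW/xsectionP/DE.
Qed.

Lemma closure_sborn (R : realType) (X : metricType R) (B : bornology X)
    (A : set (C_sborn B)) (f : C_sborn B) :
  closure A f <-> forall D (e : R), bornology_sets B D -> 0 < e ->
    exists2 g, A g & exists2 d, 0 < d &
      forall x, enlargement D d x -> `|f x - g x| < e.
Proof.
split=> [Af D e BD e0|Af W].
  have [|g [Ag fg]] := Af [set g | sborn_ent B D e (f, g)]; last by exists g.
  rewrite -nbhs_entourageE; exists (sborn_ent B D e); last first.
    by move=> g /xsectionP.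
  by exists D, e; split; last exact: subset_refl.
rewrite -nbhs_entourageE => -[E [D [e [BD e0 DE]]] EW].
by have [g Ag fg] := Af D e BD e0; exists g; split=> //; apply/EW/xsectionP/DE.
Qed.

(** * Separating functions and conclusion *)

Lemma uniform_separator_continuousType (R : realType) (X : topologicalType)
    (A V : set X) : uniform_separator A (~` V) ->
  exists g : continuousType X R, (forall x, ~ V x -> 1 <= `|0 - g x|) /\
    A `<=` [set x | 0 = g x].
Proof.
move=> /(@uniform_separatorP _ R)[g [cg _ g0 g1]].
exists (mkcts cg); split=> [x nVx|x Ax] /=; rewrite /mkcts.
  by rewrite (g1 (g x)) ?sub0r ?normrN1//; exists x.
by rewrite (g0 (g x))//; exists x.
Qed.

(** A point within [d / 2] of [enlargement D (d / 2)] lies in [enlargement D d], hence in [V]. This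
    gives a separating function that vanishes on a whole enlargement of [D]. *)
Lemma enlargement_uniform_separator (R : realType) (X : metricType R)
    (D V : set X) (d : R) : 0 < d -> enlargement D d `<=` V ->
  uniform_separator (enlargement D (d / 2)) (~` V).
Proof.
move=> d0 DV; apply: uniform_separatorW.
exists [set xy : X * X | ball xy.1 (d / 2) xy.2].
  by rewrite -entourage_ballE; exists (d / 2) => //=; rewrite divr_gt0.
rewrite -subset0 => -[x y] [[/= [a Da xa] nVy] xy]; apply: nVy; apply: DV.
exists a => //; have : ball a d y.
  rewrite [d]splitr; apply: ball_triangle xy; apply: ball_sym.
  by rewrite ballEmdist.
by move/ball_sym; rewrite ballEmdist.
Qed.

Theorem theorem3p5 (R : realType) (X : metricType R) (B : bornology X)
    (closed_baseB : has_closed_base B) :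
  [set: tightness (C_born B)] #= [set: lindelof_number B] /\
  [set: tightness (C_sborn B)] #= [set: strong_lindelof_number B].
Proof.
pose zero : continuousType X R := mkcts (@cst_continuous X R 0).
split.
- apply: (@tightness_subcover_bound _ _ _ (fun f : C_born B => (f : X -> R))
    (bornology_sets B) (fun D V => D `<=` V) _ _ _ _ _ zero).
  + by move=> f; exact: cts_fun.
  + by move=> D V W VW /subset_trans; exact.
  + by [].
  + exact: closure_born.
  (* The closed base supplies a closed [D'], so Urysohn applies to [D'] and the complement of
     [V]. *)
  + move=> D BD; have [B0 [[B0B /(_ _ BD)[D' B0D' DD']] clB0]] := closed_baseB.
    exists D'; first exact: B0B.
    move=> V oV DV; have [] := uniform_separator_continuousType R _ D' V.
      move: (pseudometric_normal R X) => /(@normal_separatorP R); apply.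
      - exact: clB0.
      - exact: open_closedC.
      - by apply/disjoints_subset; rewrite setCK.
    by move=> g [g1 g0]; exists g; split=> //; exact: subset_trans g0.
- apply: (@tightness_subcover_bound _ _ _ (fun f : C_sborn B => (f : X -> R))
    (bornology_sets B) (fun D V => exists2 d, 0 < d & enlargement D d `<=` V)
    _ _ _ _ _ zero).
  + by move=> f; exact: cts_fun.
  + by move=> D V W VW [d d0 DV]; exists d => //; exact: subset_trans VW.
  + move=> U; split=> -[Uop UB]; split=> // D /UB.
      by move=> [V [d [UV d0 DV]]]; exists V => //; exists d.
    by move=> [V UV [d d0 DV]]; exists V, d.
  + exact: closure_sborn.
  (* Half of the radius [d] is spent on separation; the other half is the radius on which [g]
     vanishes. *)
  + move=> D BD; exists D => // V oV [d d0 DV].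
    have [g [g1 g0]] := uniform_separator_continuousType R _ _ _
      (enlargement_uniform_separator _ _ _ _ _ d0 DV).
    by exists g; split=> //; exists (d / 2) => //; rewrite divr_gt0.
Qed.
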